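(* Let $Y=\{0,1\}^{\mathbb{Z}}$ be the full $2$-shift, let $X$ and $Z$ be the subshifts described in the context, and let $W=X\times Y\times Z$ with the product shift $\sigma$. If $\mu$ is any characteristic measure on $(W,\sigma)$, then the set $$\{\nu\in\mathcal{M}(W)\colon (W,\sigma,\nu)\text{ is measurably isomorphic to }(W,\sigma,\mu)\}$$ is infinite, where $\mathcal{M}(W)$ is the set of $\sigma$-invariant Borel probability measures on $W$. In particular, there is no $\mu\in\mathcal{M}(W)$ for which the set $\{\nu\in\mathcal{M}(W)\colon(W,\sigma,\nu)\text{ is measurably isomorphic to }(W,\sigma,\mu)\}$ is finite.
   Context: A subshift is a closed nonempty subset of $\mathcal{A}^{\mathbb{Z}}$ ($\mathcal{A}$ finite) invariant under the left shift $\sigma$; it is minimal if it has no nonempty proper subshift. Products of subshifts carry the product shift and are subshifts over the product alphabet. $\mathrm{Aut}(W)$ is the group of homeomorphisms of $W$ commuting with $\sigma$; a Borel probability measure $\mu$ on $W$ is characteristic if $\psi_*\mu=\mu$ for all $\psi\in\mathrm{Aut}(W)$ (in particular for $\psi=\sigma$). $\mathcal{L}(X)$ is the set of finite words occurring in elements of $X$. A minimal forbidden word of $X$ is a finite word not in $\mathcal{L}(X)$ all of whose proper subwords lie in $\mathcal{L}(X)$; $\mathcal{M}_n(X)$ is the set of those of length $n$. The SFT cover of a subshift $X$ is the sequence $(X_k)_{k\ge1}$ where $X_k$ is the set of $x\in\mathcal{A}^{\mathbb{Z}}$ in which no word of $\bigcup_{m=1}^k\mathcal{M}_m(X)$ occurs.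 The upper Banach density of $S\subseteq\mathbb{N}$ is $d^*(S)=\limsup_{n}\max_k |S\cap\{k,\dots,k+n-1\}|/n$; $X$ is language stable if $\{n\colon\mathcal{M}_n(X)=\emptyset\}$ has upper Banach density $1$. The shift $Z$: $\alpha\in(0,1)$ is irrational and $R_\alpha(x)=x+\alpha\pmod1$ on $[0,1)$. For $\beta\in(0,1)$, $X_\beta\subseteq\{0,1\}^{\mathbb{Z}}$ is the closure of the set of sequences $(x_j)_{j\in\mathbb{Z}}$, $x\in[0,1)$, with $x_j=0$ if $R_\alpha^jx\in[0,\beta)$ and $x_j=1$ otherwise. $(\beta_i)_{i\ge1}$ is a strictly increasing sequence in $\{n\alpha\pmod1\colon n\ge1\}$ with $\lim_i\beta_i=\alpha$, chosen so that $Z:=\overline{\bigcup_{i}X_{\beta_i}}$ is language stable. Put $Z_j:=X_{\beta_j}$ ($j\in\mathbb{N}$) and $Z_c:=X_\alpha$. The shift $X$: fix intervals $\{i_n,\dots,i_n+j_n\}$, with $(i_n)$ and $(j_n)$ strictly increasing, such that the $i_n$-th and $(i_n+j_n)$-th terms of the SFT cover of $Z$ coincide for all $n$. $X\subseteq\{0,1\}^{\mathbb{Z}}$ is a language stable, minimal subshift with $h_{\mathrm{top}}(X)>0$, such that the $i_n$-th and $(i_n+j_n)$-th terms of the SFT cover of $X$ coincide for infinitely many $n$, and such that $X\times Z_c$ and all $X\times Z_j$ ($j\in\mathbb{N}$) are minimal. *)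

(* Defs.v *)
From HB Require Import structures.
From mathcomp Require Import all_boot all_order all_algebra.
From mathcomp Require Import all_classical all_reals all_analysis.

Set Implicit Arguments.
Unset Strict Implicit.
Unset Printing Implicit Defensive.

Import Order.TTheory GRing.Theory Num.Theory.
Import numFieldNormedType.Exports.

Local Open Scope classical_set_scope.
Local Open Scope ring_scope.

(** ** Subshifts *)

Definition config (A : Type) : Type := int -> A.

HB.instance Definition _ (A : choiceType) :=
  Topological.copy (config A) {ptws int -> discrete_topology A}.
HB.instance Definition _ (A : pointedType) :=
  Pointed.copy (config A) {ptws int -> discrete_topology A}.

Definition left_shift {A : Type} (x : config A) : config A := fun i => x (i + 1).

(* Invariance is [left_shift @` X = X], as [X] is a set of two-sided sequences. *)
Definition subshift {A : finType} (X : set (config A)) : Prop :=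
  [/\ closed X, X !=set0 & left_shift @` X = X].

Definition minimal_subshift {A : finType} (X : set (config A)) : Prop :=
  subshift X /\ forall X', subshift X' -> X' `<=` X -> X' = X.

Definition prod_shift {A B : Type} (X : set (config A)) (Y : set (config B)) :
    set (config (A * B)) :=
  [set w | X (fst \o w) /\ Y (snd \o w)].

Definition occurs {A : eqType} (w : seq A) (x : config A) : Prop :=
  exists i : int, w = mkseq (fun k => x (i + k%:Z)) (size w).

Definition language {A : eqType} (X : set (config A)) : set (seq A) :=
  [set w | exists2 x, X x & occurs w x].

Definition min_forbidden {A : eqType} (X : set (config A)) (n : nat) :
    set (seq A) :=
  [set w | [/\ size w = n, ~ language X w
             & forall u, infix u w -> u <> w -> language X u]].

Definition SFT_cover {A : eqType} (X : set (config A)) (k : nat) :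
    set (config A) :=
  [set x | forall m w, (1 <= m <= k)%N -> min_forbidden X m w -> ~ occurs w x].

Definition upper_banach_density (R : realType) (S : set nat) : \bar R :=
  limn_esup (fun n => ereal_sup (range (fun k : nat =>
    ((count (fun i => `[< S i >]) (iota k n))%:R / n%:R : R)%:E))).

Definition language_stable (R : realType) {A : eqType} (X : set (config A)) :
    Prop :=
  upper_banach_density R [set n | min_forbidden X n = set0] = 1%E.

Definition complexity {A : finType} (X : set (config A)) (n : nat) : nat :=
  #|[pred w : n.-tuple A | `[< language X w >]]|.

(* The topological entropy of a subshift: the exponential growth rate of the
   number of its words. *)
Definition htop (R : realType) {A : finType} (X : set (config A)) : R :=
  limn (fun n => ln (complexity X n)%:R / n%:R).

(** ** Codings of rotations *)

Definition mod1 {R : realType} (x : R) : R := x - (Num.floor x)%:~R.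

Definition rotation {R : realType} (alpha x : R) : R := mod1 (x + alpha).

(* On [0, 1[ the inverse of [rotation alpha] is [rotation (- alpha)]. *)
Definition rotation_iter {R : realType} (alpha : R) (j : int) (x : R) : R :=
  match j with
  | Posz n => iter n (rotation alpha) x
  | Negz n => iter n.+1 (rotation (- alpha)) x
  end.

(* The symbols 0 and 1 are [false] and [true]. *)
Definition coding {R : realType} (alpha beta x : R) : config bool :=
  fun j => ~~ (0 <= rotation_iter alpha j x < beta).

Definition coding_shift {R : realType} (alpha beta : R) : set (config bool) :=
  closure [set coding alpha beta x | x in `[0, 1[].

Definition coding_union {R : realType} (alpha : R) (beta : nat -> R) :
    set (config bool) :=
  closure (\bigcup_i coding_shift alpha (beta i)).

(** ** Measures

   A Borel probability measure on a Borel subset [W] of [T] is represented by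
   the Borel probability measure on [T] that gives mass 1 to [W]. *)

Definition borel (T : ptopologicalType) := g_sigma_algebraType (@open T).

Section Measures.
Context {R : realType} {T : ptopologicalType}.
Implicit Types (S psi : T -> T) (W : set T) (mu nu : probability (borel T) R).

(* [psi] is only meaningful on [W]. *)
Definition automorphism S W psi : Prop :=
  exists psi' : T -> T,
    [/\ set_fun W W psi /\ set_fun W W psi',
        {in W, cancel psi psi'} /\ {in W, cancel psi' psi},
        {within W, continuous psi} /\ {within W, continuous psi'}
      & {in W, forall x, psi (S x) = S (psi x)}].

Definition characteristic S W mu : Prop :=
  mu W = 1%E /\
  forall psi, automorphism S W psi ->
    forall B : set (borel T), measurable B -> mu (W `&` psi @^-1` B) = mu B.

Definition invariant_measure S W mu : Prop :=
  mu W = 1%E /\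
  forall B : set (borel T), measurable B -> mu (W `&` S @^-1` B) = mu B.

Definition meas_isomorphic S W mu nu : Prop :=
  exists (M N : set (borel T)) (phi phi' : borel T -> borel T),
    [/\ [/\ measurable M, M `<=` W, mu M = 1%E & set_fun M M S],
        [/\ measurable N, N `<=` W, nu N = 1%E & set_fun N N S],
        [/\ set_fun M N phi, set_fun N M phi',
            {in M, cancel phi phi'} & {in N, cancel phi' phi}],
        measurable_fun M phi /\ measurable_fun N phi'
      & (forall B : set (borel T), measurable B ->
          mu (M `&` phi @^-1` B) = nu B) /\
        {in M, forall x, phi (S x) = S (phi x)}].

(* The library's measures are functions on all sets, with unspecified values
   outside the sigma-algebra.  To count measures, they have to be identified
   when they agree on Borel sets, hence the restriction. *)
Definition borel_values mu : set (borel T) -> \bar R :=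
  fun B => if `[< measurable B >] then mu B else 0%E.

Definition isomorphic_measures S W mu : set (set (borel T) -> \bar R) :=
  [set borel_values nu | nu in
    [set nu | invariant_measure S W nu /\ meas_isomorphic S W nu mu]].

End Measures.

(* Main.v *)
(** The indicator of the arc [[0, n alpha mod 1[] is, up to a constant, a sum of
    [n] translates of the indicator of [[0, alpha[], so a sliding block code maps
    the Sturmian shift [X_alpha] onto [X_beta] whenever [beta] is [n alpha]
    modulo 1; bounded discrepancy makes it injective. Hence [X_alpha] and all the
    [X_(beta i)] are conjugate; they are also pairwise disjoint, since their
    points have different frequencies of zeros. The rest of [Z] consists of
    wandering points, so any invariant measure [mu] charges the part of [W] above
    one of these pieces. Exchanging that piece with another one is a Borel
    isomorphism from [mu] to a new measure; infinitely many measures arise, since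
    [mu] gives the pieces masses that tend to 0. This works for every invariant
    [mu], characteristic or not. *)
Require Import Defs.
From HB Require Import structures.
From mathcomp Require Import all_boot all_order all_algebra.
From mathcomp Require Import all_classical all_reals all_analysis.
From mathcomp Require Import lra zify.

Set Implicit Arguments.
Unset Strict Implicit.
Unset Printing Implicit Defensive.

Import Order.TTheory GRing.Theory Num.Theory.
Import numFieldNormedType.Exports.

Local Open Scope classical_set_scope.
Local Open Scope ring_scope.

(** * Topology of configuration spaces *)

Definition cylinder {A : Type} (z : config A) (m : nat) : set (config A) :=
  [set y | forall i : int, (`|i| <= m)%N -> y i = z i].

Section ConfigTopology.
Context {A : choiceType}.
Implicit Types (z y : config A) (U K : set (config A)).

Lemma cylinder_subset z m n : (m <= n)%N -> cylinder z n `<=` cylinder z m.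
Proof. by move=> mn y yz i im; apply: yz; exact: leq_trans im mn. Qed.

Lemma eval_continuous (i : int) :
  continuous (fun z : config A => z i : discrete_topology A).
Proof.
by move=> z; exact: (@proj_continuous int (fun=> discrete_topology A) i z).
Qed.

Lemma nbhs_configP z U : nbhs z U <-> exists m, cylinder z m `<=` U.
Proof.
split; last first.
  case=> m mU; apply: (filterS mU) => {mU}.
  have nb (i : int) : nbhs z [set y | y i = z i].
    apply: (@eval_continuous i z [set z i]).
    exact: (discrete_set1 (z i : discrete_topology A)).
  elim: m => [|m IH].
    by apply: filterS (nb 0) => y yz i; rewrite leqn0 absz_eq0 => /eqP ->.
  apply: filterS (filterI IH (filterI (nb m.+1%:Z) (nb (- m.+1%:Z)))).
  move=> y [ym [/= yp yn]] i.
  rewrite leq_eqVlt => /orP[/eqP im|]; last exact: ym.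
  by case: (intP i) im => [//|n|n] /=; rewrite ?abszN /= => -[->].
(* The cylinders about [z] generate a filter. It converges to [z] because the product topology is
   the supremum of the coordinate topologies, so every neighbourhood contains a cylinder. *)
have PF : ProperFilter (filter_from setT (cylinder z)).
  apply: filter_from_proper => [|m _]; last by exists z.
  apply: filter_from_filter; first by exists 0%N.
  move=> m n _ _; exists (maxn m n) => // y yz.
  by split; apply: cylinder_subset yz; rewrite ?leq_maxl ?leq_maxr.
have /[apply] : filter_from setT (cylinder z) --> z.
  apply/cvg_sup => i V [_ [[B oB <-] Bz BV]].
  exists `|i|%N => // y yz; apply: BV => /=.
  by rewrite /preimage /= yz.
by case=> m _ mU; exists m.
Qed.

Lemma open_configP U : open U <-> forall z, U z -> exists m, cylinder z m `<=` U.
Proof.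
rewrite openE; split=> oU z Uz; first exact/nbhs_configP/oU.
exact/nbhs_configP/oU.
Qed.

Lemma closed_configP K :
  closed K <-> forall z, (forall m, exists2 y, K y & cylinder z m y) -> K z.
Proof.
split=> [cK z zK|cK z zK].
  apply: cK => V /nbhs_configP[m mV].
  by have [y Ky /mV] := zK m; exists y.
apply: cK => m; have [|y [Ky yz]] := zK (cylinder z m); last by exists y.
by apply/nbhs_configP; exists m.
Qed.

Lemma closure_configP K z :
  closure K z <-> forall m, exists2 y, K y & cylinder z m y.
Proof.
split=> [zK m|zK V /nbhs_configP[m mV]].
  have [|y [Ky yz]] := zK (cylinder z m); last by exists y.
  by apply/nbhs_configP; exists m.
by have [y Ky /mV] := zK m; exists y.
Qed.

Lemma config_hausdorff : hausdorff_space (config A).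
Proof.
apply: (@hausdorff_product int (fun=> discrete_topology A)) => _.
exact: discrete_hausdorff.
Qed.

End ConfigTopology.

Lemma config_compact (A : finType) : compact [set: config A].
Proof.
have := @tychonoff int (fun=> discrete_topology A) (fun=> setT).
have -> : [set f : int -> A | forall i, [set: A] (f i)] = setT.
  by apply/seteqP; split.
apply=> _; apply: finite_compact.
exact: (@finite_finset A setT).
Qed.

(** Uniform continuity in terms of windows: [n] depends on [m] but not on the point. Translations,
    letterwise maps and block codes all fit; commutation with the shift is treated separately. *)
Definition local_map {A B : Type} (f : config A -> config B) : Prop :=
  forall m, exists n, forall z y, cylinder z n y -> cylinder (f z) m (f y).

Lemma local_map_continuous {A B : choiceType} (f : config A -> config B) :
  local_map f -> continuous f.
Proof.
move=> lf z V /nbhs_configP[m mV]; have [n fn] := lf m.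
by apply/nbhs_configP; exists n => y /fn /mV.
Qed.

Lemma local_map_closure {A B : choiceType} (f : config A -> config B) K z :
  local_map f -> closure K z -> closure (f @` K) (f z).
Proof.
move=> lf /closure_configP zK; apply/closure_configP => m.
have [n fn] := lf m; have [y Ky yz] := zK n.
by exists (f y); [exists y|exact: fn].
Qed.

Lemma local_map_pointwise {A B : Type} (g : A -> B) :
  local_map (fun z : config A => (g \o z : config B)).
Proof. by move=> m; exists m => z y yz i im /=; rewrite yz. Qed.

Lemma translate_local {A : Type} (t : int) :
  local_map (fun z : config A => (fun j => z (j + t)) : config A).
Proof. by move=> m; exists (m + `|t|)%N => z y yz j jm; apply: yz; lia. Qed.

Lemma left_shift_local {A : Type} : local_map (@left_shift A).
Proof. exact: translate_local. Qed.

(** * Codings of rotations *)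

Section Mod1.
Context {R : realType}.
Implicit Types (s t x alpha : R).

Lemma mod1_itv t : 0 <= mod1 t < 1.
Proof. by have := floor_itv t; rewrite /mod1 intrD => /andP[? ?]; lra. Qed.

Lemma mod1_unique t x (m : int) : 0 <= x < 1 -> t = x + m%:~R -> mod1 t = x.
Proof.
move=> x01 ->; rewrite /mod1 (@floor_def _ _ m); first lra.
by rewrite intrD; move: x01 => /andP[? ?]; lra.
Qed.

Lemma mod1_id x : 0 <= x < 1 -> mod1 x = x.
Proof. by move=> x01; apply: (mod1_unique (m := 0)) => //; rewrite addr0. Qed.

Lemma mod1_addl s t : mod1 (mod1 s + t) = mod1 (s + t).
Proof.
apply: (mod1_unique (m := Num.floor (s + t) - Num.floor s)).
  exact: mod1_itv.
by rewrite /mod1 intrB; lra.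
Qed.

(* The indicator of an arc is its length plus a coboundary of the rotation by
   that length. *)
Lemma mod1_indicator s t :
  (mod1 t < mod1 s)%R%:R = mod1 (t - s) - mod1 t + mod1 s.
Proof.
have /andP[s0 s1] := mod1_itv s; have /andP[t0 t1] := mod1_itv t.
have [ts|st] := ltP (mod1 t) (mod1 s) => /=.
  rewrite (@mod1_unique (t - s) (mod1 t - mod1 s + 1)
    (Num.floor t - Num.floor s - 1)); [lra|lra|].
  by rewrite !intrB /mod1; lra.
rewrite (@mod1_unique (t - s) (mod1 t - mod1 s) (Num.floor t - Num.floor s)).
- lra.
- lra.
- by rewrite !intrB /mod1; lra.
Qed.

Lemma rotation_iter_mod1 alpha (j : int) x : 0 <= x < 1 ->
  rotation_iter alpha j x = mod1 (x + j%:~R * alpha).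
Proof.
move=> x01.
have it (n : nat) gamma : iter n (rotation gamma) x = mod1 (x + n%:R * gamma).
  elim: n => [|n IH] /=; first by rewrite mul0r addr0 mod1_id.
  by rewrite IH /rotation mod1_addl -addrA -[n.+1]addn1 natrD; congr mod1; lra.
case: j => n; first by rewrite /= it.
by rewrite [LHS]it NegzE mulrNz mulrN mulNr pmulrn.
Qed.

Lemma codingE alpha beta x (j : int) : 0 <= x < 1 ->
  coding alpha beta x j = ~~ (mod1 (x + j%:~R * alpha) < beta).
Proof.
move=> x01; rewrite /coding rotation_iter_mod1//.
by have /andP[->] := mod1_itv (x + j%:~R * alpha).
Qed.

End Mod1.

(** * Counting zeros, and the block codes between codings *)

Definition zero_at (z : config bool) (j : int) : int := (~~ z j)%:Z.

(* The number of zeros of [z] at the positions [j - n + 1, ..., j]. *)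
Definition zeros (n : nat) (z : config bool) (j : int) : int :=
  \sum_(i < n) zero_at z (j - i%:Z).

(** The block code from the Sturmian shift to the coding of the arc of length [mod1 (n%:R * alpha)].
    A Sturmian window of length [n] has either the floor of [n * alpha] zeros or one more; the extra
    zero marks a visit to the arc, which is coded by 0. *)
Definition arc_code {R : realType} (alpha : R) (n : nat) (z : config bool) :
    config bool :=
  fun j => zeros n z j <= Num.floor (n%:R * alpha).

Section Zeros.
Implicit Types (z : config bool) (j : int).

Lemma zeros_cylinder n z y m : cylinder z (m + n) y ->
  forall j, (`|j| <= m)%N -> zeros n y j = zeros n z j.
Proof.
move=> yz j jm; apply: eq_bigr => i _; have := ltn_ord i => im.
by rewrite /zero_at yz//; lia.
Qed.

Lemma zerosD m n z j : zeros (m + n) z j = zeros m z j + zeros n z (j - m%:Z).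
Proof.
rewrite /zeros big_split_ord /=; congr (_ + _); apply: eq_bigr => i _.
by congr zero_at; lia.
Qed.

Lemma zeros1 z j : zeros 1 z j = zero_at z j.
Proof. by rewrite /zeros big_ord1 subr0. Qed.

Lemma zerosS n z j : zeros n.+1 z j = zero_at z j + zeros n z (j - 1).
Proof. by rewrite -add1n zerosD zeros1. Qed.

Lemma zerosSr n z j : zeros n.+1 z j = zeros n z j + zero_at z (j - n%:Z).
Proof. by rewrite -addn1 zerosD zeros1. Qed.

Lemma zerosM m n z j :
  zeros (m * n) z j = \sum_(i < m) zeros n z (j - (i * n)%N%:Z).
Proof.
elim: m j => [|m IH] j; first by rewrite /zeros !big_ord0.
rewrite mulSn zerosD IH big_ord_recl mul0n subr0; congr (_ + _).
by apply: eq_bigr => i _; congr zeros; rewrite lift0; lia.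
Qed.

Lemma arc_code_local {R : realType} (alpha : R) n :
  local_map (arc_code alpha n).
Proof.
move=> m; exists (m + n)%N => z y yz j jm.
by rewrite /arc_code (zeros_cylinder yz).
Qed.

Lemma arc_code_shift {R : realType} (alpha : R) n z :
  arc_code alpha n (left_shift z) = left_shift (arc_code alpha n z).
Proof.
apply/funext => j; rewrite /arc_code /left_shift; congr (_ <= _).
apply: eq_bigr => i _; rewrite /zero_at; congr (~~ z _)%:Z; lia.
Qed.

End Zeros.

Section Codings.
Context {R : realType} {alpha : R}.
Hypothesis alpha01 : 0 < alpha < 1.
Implicit Types (x : R) (y z : config bool).

Lemma alpha_mod1 : mod1 alpha = alpha.
Proof. by apply: mod1_id; case/andP: alpha01 => *; lra. Qed.

(** By [mod1_indicator] each zero contributes [alpha] plus a coboundary of the rotation. The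
    coboundaries telescope over the window, and the same identity recognises the total as the
    indicator of the longer arc. *)
Lemma zeros_coding n x (j : int) : 0 <= x < 1 ->
  zeros n (coding alpha alpha x) j =
  Num.floor (n%:R * alpha) + zero_at (coding alpha (mod1 (n%:R * alpha)) x) j.
Proof.
move=> x01; apply: (@intr_inj R); rewrite intrD /zero_at codingE// negbK.
rewrite -[in RHS]pmulrn.
rewrite (@mod1_indicator R) /zeros raddf_sum /=.
set t := x + j%:~R * alpha.
transitivity (\sum_(i < n)
   (mod1 (t - i.+1%:R * alpha) - mod1 (t - i%:R * alpha) + alpha)).
  apply: eq_bigr => i _; rewrite /zero_at codingE// negbK -pmulrn.
  have -> : x + (j - i%:Z)%:~R * alpha = t - i%:R * alpha.
    by rewrite intrB /t -pmulrn; lra.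
  rewrite -[X in _ < X]alpha_mod1 (@mod1_indicator R) alpha_mod1.
  by congr (mod1 _ - _ + _); rewrite -[i.+1]addn1 natrD; lra.
rewrite big_split /= -(big_mkord xpredT (fun i : nat =>
  mod1 (t - i.+1%:R * alpha) - mod1 (t - i%:R * alpha))).
rewrite telescope_sumr// mul0r subr0 sumr_const card_ord -mulr_natl.
by rewrite /mod1; lra.
Qed.

Lemma arc_code_coding n x : 0 <= x < 1 ->
  arc_code alpha n (coding alpha alpha x) =
  coding alpha (mod1 (n%:R * alpha)) x.
Proof.
move=> x01; apply/funext => j; rewrite /arc_code zeros_coding//.
by rewrite /zero_at; case: (coding _ _ _ _) => /=; rewrite ?addr0 ?lexx ?gerDl.
Qed.

(** Both sides depend on finitely many coordinates of [z], so the identity passes from codings to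
    their closure. *)
Lemma zeros_sturmian n z (j : int) : coding_shift alpha alpha z ->
  zeros n z j = Num.floor (n%:R * alpha) + zero_at (arc_code alpha n z) j.
Proof.
move=> /closure_configP /(_ (`|j| + n)%N) [_ [x /= x01 <-] yz].
rewrite in_itv /= in x01.
rewrite -(zeros_cylinder yz)// zeros_coding//; congr (_ + _).
rewrite /zero_at; congr (~~ _)%:Z.
rewrite -arc_code_coding//; rewrite /arc_code; congr (_ <= _).
exact: (zeros_cylinder yz).
Qed.

Lemma zeros_balanced n z (j : int) : coding_shift alpha alpha z ->
  `|(zeros n z j)%:~R - n%:R * alpha| <= 1.
Proof.
move=> /zeros_sturmian ->; rewrite intrD.
have := floor_itv (n%:R * alpha); rewrite intrD => /andP[? ?].
by rewrite ler_norml /zero_at; case: (arc_code _ _ _ _) => /=; lra.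
Qed.

Lemma arc_code_image n :
  arc_code alpha n @` coding_shift alpha alpha =
  coding_shift alpha (mod1 (n%:R * alpha)).
Proof.
apply/seteqP; split=> [_ [z zX <-]|z zX].
  have := local_map_closure (@arc_code_local _ alpha n) zX.
  apply: closure_subset => _ [_ [x /= x01 <-] <-].
  by exists x => //; rewrite arc_code_coding.
(* The image of a compact set is closed; as it contains all codings for the new arc, it contains
   their closure. *)
have cl : closed (arc_code alpha n @` coding_shift alpha alpha).
  apply: (compact_closed config_hausdorff).
  apply: continuous_compact.
    apply: continuous_subspaceT; exact/local_map_continuous/arc_code_local.
  apply: (subclosed_compact _ (@config_compact bool)) => //.
  exact: closed_closure.
rewrite ((closure_id _).1 cl); move: zX.
apply: closure_subset => _ [x /= x01 <-].
exists (coding alpha alpha x); last by rewrite arc_code_coding.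
by apply: subset_closure; exists x.
Qed.

End Codings.

(** * Diophantine properties of an irrational rotation number *)

Section Irrational.
Context {R : realType} {alpha : R}.
Hypothesis alpha_irr : irrational alpha.

Lemma irrational_mulr_int n (p : int) : n%:R * alpha = p%:~R -> n = 0%N.
Proof.
case: n => // n nap; exfalso; apply: alpha_irr.
exists (p%:~R / n.+1%:R) => //.
by rewrite fmorph_div /= ratr_int ratr_nat -nap mulrC mulKf// pnatr_eq0.
Qed.

(** Pigeonhole: among the [N.+1] fractional parts of [i * n * alpha] with [i <= N], two fall into
    the same interval of length 1/N. Irrationality makes their difference nonzero. *)
Lemma dirichlet n (e : R) : (0 < n)%N -> 0 < e -> exists (q : nat) (p : int),
  (0 < q)%N /\ 0 < `|(q * n)%:R * alpha - p%:~R| < e.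
Proof.
move=> n0 e0; pose N := (Num.truncn e^-1).+1.
have Ne : N%:R^-1 < e.
  rewrite -[ltRHS]invrK ltf_pV2 ?posrE ?invr_gt0 ?ltr0n//.
  by rewrite truncnS_gt.
have N0 : 0 < N%:R :> R by rewrite ltr0n.
pose u (i : nat) : R := mod1 ((i * n)%:R * alpha).
have u01 i : 0 <= u i < 1 by exact: mod1_itv.
have fN i : (Num.truncn (N%:R * u i) < N)%N.
  have /andP[u0 u1] := u01 i.
  by rewrite truncn_lt_nat ?mulr_ge0// ?ltW// gtr_pMr.
pose f (i : 'I_N.+1) : 'I_N := Ordinal (fN i).
have : ~~ injectiveb f.
  by apply/injectiveP => /leq_card; rewrite !card_ord ltnn.
case/injectivePn => i [j ij fij].
wlog ltij : i j ij fij / (i < j)%N.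
  move=> wl; have [|ji] := ltnP i j; first exact: (wl i j).
  by apply: (wl j i) => //; rewrite 1?eq_sym// ltn_neqAle ji andbT eq_sym.
exists (j - i)%N.
exists (Num.floor ((j * n)%:R * alpha) - Num.floor ((i * n)%:R * alpha)).
rewrite subn_gt0 ltij; split=> //; apply/andP; split.
  rewrite normr_gt0 subr_eq0; apply/eqP => /irrational_mulr_int /eqP.
  by rewrite muln_eq0 subn_eq0 leqNgt ltij /= -leqn0 leqNgt n0.
apply: lt_trans Ne.
have -> : ((j - i) * n)%:R * alpha -
    (Num.floor ((j * n)%:R * alpha) - Num.floor ((i * n)%:R * alpha))%:~R =
    u j - u i.
  by rewrite mulnBl natrB ?leq_mul2r ?(ltnW ltij) ?orbT// intrB /u /mod1; lra.
have tr (k : nat) : (Num.truncn (N%:R * u k))%:R <= N%:R * u k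
    < (Num.truncn (N%:R * u k))%:R + 1.
  have /andP[u0 _] := u01 k.
  by rewrite [X in _ < X]natr1 truncn_itv// mulr_ge0// ltW.
have := tr i; have := tr j.
have /= -> := congr1 val fij => /andP[? ?] /andP[? ?].
rewrite -(ltr_pM2l N0) mulfV ?gt_eqF//.
by rewrite -[X in X * _]gtr0_norm// -normrM mulrBr ltr_norml; lra.
Qed.

(** Induction on [L]: the fractional part [u] of the new multiple is positive by irrationality, and
    no integer is closer to that multiple than the smaller of [u] and [1 - u]. *)
Lemma int_multiples_gap (L : nat) : exists2 d : R, 0 < d &
  forall (k : nat) (p : int), (0 < k <= L)%N -> d <= `|k%:R * alpha - p%:~R|.
Proof.
elim: L => [|L [d d0 dL]]; first by exists 1 => // -[|k].
pose u := mod1 (L.+1%:R * alpha).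
have u0 : 0 < u.
  rewrite lt_neqAle; have /andP[-> _] := mod1_itv (L.+1%:R * alpha).
  rewrite andbT eq_sym subr_eq0; apply/eqP.
  by move=> /irrational_mulr_int.
have u1 : u < 1 by have /andP[] := mod1_itv (L.+1%:R * alpha).
exists (Num.min d (Num.min u (1 - u))).
  by rewrite !lt_min d0 u0 subr_gt0 u1.
move=> k p /andP[k0]; rewrite leq_eqVlt => /predU1P[->|kL]; last first.
  by rewrite ge_min dL// k0.
rewrite !ge_min; apply/orP; right.
have ue : L.+1%:R * alpha = u + (Num.floor (L.+1%:R * alpha))%:~R.
  by rewrite /u /mod1; lra.
rewrite ue; have [pf|fp] := leP p (Num.floor (L.+1%:R * alpha)).
  apply/orP; left; apply: le_trans (ler_norm _).
  by move: pf; rewrite -(ler_int R); lra.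
apply/orP; right; rewrite distrC; apply: le_trans (ler_norm _).
by move: fp; rewrite -lezD1 -(ler_int R) intrD; lra.
Qed.

End Irrational.

(** * Injectivity of the block codes, and frequencies of zeros *)

Section Sturmian.
Context {R : realType} {alpha : R}.
Hypotheses (alpha01 : 0 < alpha < 1) (alpha_irr : irrational alpha).
Implicit Types (x : R) (y z : config bool).

(* If [z] were 0 along the progression, each window of length [N] from one term
   to the next would contain exactly [p] zeros, where [N * alpha] is close to
   the integer [p], whereas the discrepancy of [z] is bounded. *)
Lemma sturmian_progression z n (j : int) : coding_shift alpha alpha z ->
  (0 < n)%N -> ~ (forall m : nat, z (j - (m * n)%N%:Z) = false).
Proof.
move=> zX n0 zj; have /andP[a0 a1] := alpha01.
have a1' : 0 < 1 - alpha by lra.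
have [q [p [q0 /andP[d0 d1]]]] := dirichlet alpha_irr n0 a1'.
set d := _ - p%:~R in d0 d1.
have [N NE] : exists N, (q * n)%N = N.+1.
  by exists (q * n).-1; rewrite prednK// muln_gt0 q0.
have win (m : nat) : zeros N.+1 z (j - (m * N.+1)%N%:Z) = p.
  set i := j - _.
  have zi : z i = false by rewrite /i -NE mulnA zj.
  have ziN : z (i - N.+1%:Z) = false.
    by rewrite -(zj (m.+1 * q)%N) -mulnA NE /i; congr (z _); lia.
  (* The window of length [N.+2] has zeros at both ends. Balance for the lengths [N] and [N.+2]
     therefore puts the count for length [N.+1] within [alpha] of [N.+1 * alpha], hence at distance
     less than 1 from [p]; this is why the approximation was taken within [1 - alpha]. *)
  have := zeros_balanced alpha01 N.+2 i zX.
  have := zeros_balanced alpha01 N (i - 1) zX.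
  rewrite zerosSr zerosS /zero_at zi ziN /=.
  move: d1; rewrite /d NE !ltr_norml !ler_norml.
  rewrite -[N.+2]addn1 -[N.+1]addn1 !natrD.
  rewrite !intrD /=.
  set w := zeros N z (i - 1) => /andP[? ?] /andP[? ?] /andP[? ?].
  have : -1 < (1 + w - p)%:~R :> R by rewrite intrB intrD; lra.
  have : (1 + w - p)%:~R < 1 :> R by rewrite intrB intrD; lra.
  rewrite -[1]/(1%:~R) -intrN !ltr_int; lia.
have total (Q : nat) : Q%:R * `|d| <= 1.
  have := zeros_balanced alpha01 (Q * N.+1) j zX.
  rewrite zerosM (eq_bigr (fun=> p)) => [|i _]; last exact: win.
  rewrite sumr_const card_ord -[p *+ Q]mulr_natl intrM rmorph_nat natrM.
  rewrite -mulrA -mulrBr.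
  by rewrite normrM normr_nat distrC /d NE.
have := total (Num.truncn `|d|^-1).+1; apply/negP; rewrite -ltNge.
by rewrite -ltr_pdivrMr// mul1r truncnS_gt.
Qed.

(** Equal codes mean equal zero counts in all windows of length [n]. Comparing consecutive windows
    makes the difference of [y] and [z] periodic with period [n], so a disagreement would force one
    of them to be 0 along a whole progression, against [sturmian_progression]. *)
Lemma arc_code_inj n y z : (0 < n)%N ->
  coding_shift alpha alpha y -> coding_shift alpha alpha z ->
  arc_code alpha n y = arc_code alpha n z -> y = z.
Proof.
move=> n0 yX zX Fyz.
have step i : zero_at y i - zero_at z i =
    zero_at y (i - n%:Z) - zero_at z (i - n%:Z).
  have e k : zeros n y k = zeros n z k.
    by rewrite !(zeros_sturmian alpha01)// Fyz.
  have := zerosS n y i; have := zerosS n z i; rewrite !zerosSr !e; lia.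
have per i (m : nat) :
    zero_at y (i - (m * n)%N%:Z) - zero_at z (i - (m * n)%N%:Z) =
    zero_at y i - zero_at z i.
  elim: m => [|m IH]; first by rewrite mul0n subr0.
  by rewrite -IH [in RHS]step; congr (zero_at _ _ - zero_at _ _); lia.
apply/funext => i; case yi : (y i); case zi : (z i) => //; exfalso.
  apply: (sturmian_progression (n := n) (j := i) zX n0) => m.
  by have := per i m; rewrite /zero_at yi zi; case: (z _); case: (y _).
apply: (sturmian_progression (n := n) (j := i) yX n0) => m.
by have := per i m; rewrite /zero_at yi zi; case: (z _); case: (y _).
Qed.

(** Pulled back to a Sturmian point [y], the count is a sum of [k] shifted counts of [y], up to a
    constant; each of them has discrepancy at most 1. *)
Lemma arc_discrepancy k z m (j : int) :
  coding_shift alpha (mod1 (k%:R * alpha)) z ->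
  `|(zeros m z j)%:~R - m%:R * mod1 (k%:R * alpha)| <= k%:R.
Proof.
rewrite -(arc_code_image alpha01) => -[y yX <-].
have -> : (zeros m (arc_code alpha k y) j)%:~R - m%:R * mod1 (k%:R * alpha) =
    \sum_(l < k) ((zeros m y (j - l%:Z))%:~R - m%:R * alpha).
  rewrite sumrB sumr_const card_ord -mulr_natl.
  have -> : zeros m (arc_code alpha k y) j =
      \sum_(l < k) zeros m y (j - l%:Z) - m%:Z * Num.floor (k%:R * alpha).
    rewrite /zeros exchange_big /= -[m%:Z]natz mulr_natl.
    rewrite -[in X in _ - X](card_ord m) -sumr_const -sumrB.
    apply: eq_bigr => i _.
    have := zeros_sturmian alpha01 k (j - i%:Z) yX; rewrite /zeros.
    under eq_bigr do rewrite addrAC.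
    by move=> ->; lia.
  by rewrite intrB intrM raddf_sum /= -pmulrn /mod1; lra.
have -> : k%:R = \sum_(l < k) 1 :> R by rewrite sumr_const card_ord.
apply: (le_trans (ler_norm_sum _ _ _)); apply: ler_sum => l _.
exact: zeros_balanced.
Qed.

(** The frequency of zeros of [z] determines the slope: two different slopes would drift apart
    linearly in [m], while both discrepancies stay bounded. *)
Lemma coding_shift_slope k l z :
  coding_shift alpha (mod1 (k%:R * alpha)) z ->
  coding_shift alpha (mod1 (l%:R * alpha)) z ->
  mod1 (k%:R * alpha) = mod1 (l%:R * alpha).
Proof.
move=> zk zl; apply/eqP; rewrite -subr_eq0 -normr_le0 leNgt; apply/negP.
set d := `|_| => d0.
have bd (m : nat) : m%:R * d <= k%:R + l%:R.
  rewrite /d -[X in X * _]normr_nat -normrM mulrBr.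
  have := arc_discrepancy m 0 zk; have := arc_discrepancy m 0 zl.
  rewrite !ler_norml.
  by move=> /andP[? ?] /andP[? ?]; lra.
have := bd (Num.truncn ((k%:R + l%:R) / d)).+1; apply/negP; rewrite -ltNge.
by rewrite -ltr_pdivrMr// truncnS_gt.
Qed.

End Sturmian.

(** * Translates of codings, and points of the union off the pieces *)

Section Translation.
Context {R : realType} {alpha : R}.
Implicit Types (x : R) (z : config bool).

Lemma coding_translate beta x (t j : int) : 0 <= x < 1 ->
  coding alpha beta x (j + t) = coding alpha beta (mod1 (x + t%:~R * alpha)) j.
Proof.
move=> x01; rewrite !codingE ?mod1_itv// mod1_addl -addrA.
by rewrite intrD mulrDl [X in _ + X]addrC.
Qed.

Lemma coding_shift_translate beta (t : int) z :
  coding_shift alpha beta z ->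
  coding_shift alpha beta (fun j => z (j + t)).
Proof.
move=> /(local_map_closure (@translate_local _ t)).
apply: closure_subset => _ [_ [x /= x01 <-] <-].
exists (mod1 (x + t%:~R * alpha)); first by rewrite /= in_itv /= mod1_itv.
by apply/funext => j; rewrite coding_translate.
Qed.

Lemma left_shift_coding_shift beta z :
  coding_shift alpha beta (left_shift z) <-> coding_shift alpha beta z.
Proof.
split; last exact: coding_shift_translate.
move=> /(coding_shift_translate (t := -1)).
by rewrite /left_shift; under eq_fun do rewrite subrK.
Qed.

End Translation.

(** A quantitative form of lying outside the closed set [coding_shift alpha alpha]. For fixed [m] it
    depends on finitely many coordinates only, which gives measurability, and the union over [m] is
    the whole complement. *)
Definition far_from_codings {R : realType} (alpha : R) (m : nat) :
    set (config bool) :=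
  [set z | forall x, 0 <= x < 1 -> ~ cylinder z m (coding alpha alpha x)].

Lemma notin_coding_shift {R : realType} (alpha : R) z :
  ~ coding_shift alpha alpha z -> exists m, far_from_codings alpha m z.
Proof.
move=> zX; apply: contrapT => /forallNP zfar; apply: zX.
apply/closure_configP => m; have /existsNP[x] := zfar m.
move=> /not_implyP[x01 /contrapT xz].
by exists (coding alpha alpha x) => //; exists x => //=; rewrite in_itv.
Qed.

(* A point [z] of the union that lies in none of the [coding_shift alpha (beta i)]
   is approximated by codings with [beta i] arbitrarily close to [alpha]; such a
   coding differs from a Sturmian one only at visits to the short arc
   [[beta i, alpha[], which are far apart. *)
Lemma far_from_codings_once {R : realType} (alpha : R) (beta : nat -> R)
    (z : config bool) (m n : nat) :
  irrational alpha -> (forall i, beta i < alpha) -> beta @ \oo --> alpha ->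
  coding_union alpha beta z -> (forall i, ~ coding_shift alpha (beta i) z) ->
  far_from_codings alpha m z -> (2 * m < n)%N ->
  ~ far_from_codings alpha m (fun j => z (j + n%:Z)).
Proof.
move=> alpha_irr beta_lt beta_lim zU zN zm mn znm.
have [d d0 gap] := int_multiples_gap alpha_irr (n + 2 * m).
have [K _ KP] : \forall k \near \oo, alpha - beta k < d.
  move/cvgrPdist_lt : beta_lim => /(_ d d0); apply: filterS => k.
  by rewrite gtr0_norm ?subr_gt0.
(* Each of the finitely many closed pieces of index below [K] misses some cylinder about [z].
   Approximating [z] beyond [M] thus forces an index [k] with [alpha - beta k < d]. *)
have [M Mfar] : exists M, forall k, (k < K)%N ->
    forall y, cylinder z M y -> ~ coding_shift alpha (beta k) y.
  elim: K {KP} => [|K [M IH]]; first by exists 0%N.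
  have /existsNP[M' M'far] : ~ forall m, exists2 y,
      coding_shift alpha (beta K) y & cylinder z m y.
    by move=> zK; exact: (zN K ((closed_configP _).1 (@closed_closure _ _) z zK)).
  exists (maxn M M') => k; rewrite ltnS leq_eqVlt => /predU1P[->|kK] y yz yk.
    by apply: M'far; exists y => //; exact: cylinder_subset (leq_maxr _ _) _ yz.
  by apply: (IH k) yk => //; exact: cylinder_subset (leq_maxl _ _) _ yz.
have /closure_configP/(_ (maxn M (n + m)))[y [k _ yk] yz] := zU.
have Kk : (K <= k)%N.
  rewrite leqNgt; apply/negP => /Mfar; apply; last exact: yk.
  exact: cylinder_subset (leq_maxl _ _) _ yz.
have /closure_configP/(_ (n + m)%N)[_ [x /= x01 <-] xy] := yk.
have {y yz yk xy} xz : cylinder z (n + m) (coding alpha (beta k) x).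
  by move=> j jm; rewrite xy// yz//; exact: leq_trans jm (leq_maxr _ _).
rewrite in_itv /= in x01.
have visit (j : int) : (`|j| <= n + m)%N -> coding alpha alpha x j <> z j ->
    beta k <= mod1 (x + j%:~R * alpha) < alpha.
  move=> jm; rewrite -xz// !codingE//.
  set u := mod1 _; have lt_u : u < beta k -> u < alpha by move/lt_trans; apply.
  rewrite leNgt; case: (u < beta k) lt_u => [-> //|_].
  by case: (u < alpha).
have [i [im /visit]] : exists i : int,
    (`|i| <= m)%N /\ coding alpha alpha x i <> z i.
  apply: contrapT => /forallNP h; apply: (zm x x01) => i im.
  by apply: contrapT => hi; apply: (h i).
have [j [jm]] : exists j : int, (`|j| <= m)%N /\
    coding alpha alpha x (j + n%:Z) <> z (j + n%:Z).
  apply: contrapT => /forallNP h.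
  apply: (znm _ (mod1_itv (x + n%:R * alpha))) => j jm.
  by apply: contrapT => hj; apply: (h j); rewrite coding_translate.
move=> /visit vj vi.
have {}vj : beta k <= mod1 (x + (j + n%:Z)%:~R * alpha) < alpha.
  by apply: vj; lia.
have {}vi : beta k <= mod1 (x + i%:~R * alpha) < alpha by apply: vi; lia.
(* The two visits are [l] steps apart, and [l] is positive because [2 * m < n]. Both lie in an arc
   of length [alpha - beta k], so [l * alpha] is closer than [d] to an integer, against [gap]. *)
pose l := absz (j + n%:Z - i)%R.
have lE : l%:Z = j + n%:Z - i by rewrite /l; lia.
have := gap l (Num.floor (x + (j + n%:Z)%:~R * alpha) -
               Num.floor (x + i%:~R * alpha)).
have -> : (0 < l <= n + 2 * m)%N by rewrite /l; lia.
move=> /(_ isT); apply/negP; rewrite -ltNge.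
apply: le_lt_trans (KP k Kk); rewrite ler_norml.
have -> : l%:R * alpha = (j + n%:Z - i)%:~R * alpha by rewrite -lE -pmulrn.
move: vj vi; rewrite /mod1 !intrB !intrD -!pmulrn => /andP[? ?] /andP[? ?].
by lra.
Qed.

(** * Wandering sets and Borel maps *)

Lemma infinite_range_inj {T : Type} (A : set T) (g : nat -> T) :
  injective g -> range g `<=` A -> infinite_set A.
Proof.
move=> ginj gA /(sub_finite_set gA).
rewrite (eq_finite_set (inj_card_eq _)); first exact: infinite_nat.
by move=> m n _ _ /ginj.
Qed.

Section Probability.
Context {d : measure_display} {T : measurableType d} {R : realType}.
Variable mu : probability T R.

(** The tail unions decrease to the empty set, so their measures tend to 0 by continuity from
    above. *)
Lemma probability_trivIset_cvg0 (V : nat -> set T) (c : \bar R) :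
  (forall n, measurable (V n)) -> trivIset setT V -> (0 < c)%E ->
  exists N, forall n, (N <= n)%N -> (mu (V n) < c)%E.
Proof.
move=> mV tV c0; pose U n := \bigcup_(k in [set k | (n <= k)%N]) V k.
have mU n : measurable (U n) by exact: bigcup_measurable.
have capU : \bigcap_n U n = set0.
  rewrite -subset0 => x xU; have [k _ xk] := xU 0%N I.
  have [l /= kl xl] := xU k.+1 I.
  have /(_ I I) kl' := tV k l.
  by move: kl; rewrite -kl' ?ltnn//; exists x.
have : mu \o U @ \oo --> mu (\bigcap_n U n).
  apply: nonincreasing_cvg_mu => //.
  - by rewrite (le_lt_trans (probability_le1 _ _)) ?ltry.
  - by rewrite capU.
  - move=> m n mn; apply/subsetPset => x [k /= nk xk].
    by exists k => //=; exact: leq_trans nk.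
rewrite capU measure0 => /(_ [set y | (y < c)%E]) [].
  by apply: open_nbhs_nbhs; split => //; exact: open_ereal_lt_ereal.
move=> N _ NP; exists N => n Nn; apply: le_lt_trans (NP n Nn).
by apply: le_measure; rewrite ?inE// => x xn; exists n => /=.
Qed.

Variable S : T -> T.
Hypotheses (mS : measurable_fun setT S)
  (S_inv : forall B, measurable B -> mu (S @^-1` B) = mu B).

Lemma wandering_null (E : set T) (p : nat) : measurable E ->
  (forall n x, (p < n)%N -> E x -> ~ E (iter n S x)) -> mu E = 0%E.
Proof.
move=> mE Ewand; apply/eqP; rewrite -measure_le0 leNgt; apply/negP => E0.
have mSn n B : measurable B -> measurable (iter n S @^-1` B) /\
    mu (iter n S @^-1` B) = mu B.
  move=> mB; elim: n => [//|n [IH1 IH2]].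
  have -> : iter n.+1 S @^-1` B = S @^-1` (iter n S @^-1` B).
    by apply/funext => x; rewrite /preimage /= -iterSr.
  by split; [rewrite -[X in measurable X]setTI; exact: mS|rewrite S_inv].
(* Two different multiples of [p.+1] differ by more than [p], so these preimages of [E] are pairwise
   disjoint; all have the mass of [E], which cannot be positive. *)
have [|i j _ _ [x [xi xj]]|N NP] :=
    @probability_trivIset_cvg0 (fun n => iter (n * p.+1) S @^-1` E) (mu E) _ _ E0.
- by move=> n; exact: (mSn _ _ mE).1.
- apply: contrapT => /eqP ij.
  wlog ltij : i j xi xj ij / (i < j)%N.
    move=> wl; have [|ji] := ltnP i j; first exact: (wl i j).
    by apply: (wl j i) => //; rewrite 1?eq_sym// ltn_neqAle ji andbT eq_sym.
  apply: (Ewand ((j - i) * p.+1)%N _ _ xi).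
    by apply: leq_pmull; rewrite subn_gt0.
  by rewrite -iterD -mulnDl subnK// ltnW.
by have := NP N (leqnn N); rewrite (mSn _ _ mE).2 ltxx.
Qed.

Lemma probability_image (f : T -> T) : measurable_fun setT f ->
  exists nu : probability T R, forall B, nu B = mu (f @^-1` B).
Proof.
move=> mf; pose mix := isMeasurableFun.Build _ _ _ _ f mf.
pose g : {mfun T >-> T} := HB.pack f mix.
by exists (distribution mu g).
Qed.

End Probability.

Section BorelMaps.
Context {T : ptopologicalType}.

Lemma borel_open (U : set T) : open U -> measurable (U : set (borel T)).
Proof. by move=> oU; exact: sub_sigma_algebra. Qed.

Lemma borel_closed (K : set T) : closed K -> measurable (K : set (borel T)).
Proof.
move=> cK; rewrite -[K]setCK; apply: measurableC; apply: borel_open.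
exact: closed_openC.
Qed.

Lemma continuous_borel (f : T -> T) : continuous f ->
  measurable_fun setT (f : borel T -> borel T).
Proof.
move=> cf.
apply: (@measurability _ _ (borel T) (borel T) _ _ (@open T)) => // _ [U oU <-].
by rewrite setTI; apply: borel_open; apply: open_comp => // x _; exact: cf.
Qed.

(** Compactness makes [f] map closed subsets of [K] to closed sets, so the preimage of an open set
    under the inverse is a difference of two closed sets. *)
Lemma compact_inverse_borel (K : set T) (f g : T -> T) :
  hausdorff_space T -> compact K -> continuous f -> {in K, cancel f g} ->
  measurable_fun (f @` K : set (borel T)) (g : borel T -> borel T).
Proof.
move=> hT cK cf fg; have cim C : closed C -> closed (f @` (K `&` C)).
  move=> cC; apply: compact_closed => //; apply: continuous_compact.
    exact: continuous_subspaceT.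
  apply: (subclosed_compact _ cK); last exact: subIsetl.
  by apply: closedI => //; exact: compact_closed.
apply: (@measurability _ _ (borel T) (borel T) _ _ (@open T)) => // _ [U oU <-].
have -> : f @` K `&` g @^-1` U = f @` (K `&` setT) `\` f @` (K `&` ~` U).
  apply/seteqP; split=> y; rewrite /preimage.
    move=> /= -[[x Kx <-]]; rewrite fg ?inE// => Ux; split; first by exists x.
    move=> [x' [Kx' nUx']] /(congr1 g); rewrite !fg ?inE// => xx'.
    by apply: nUx'; rewrite xx'.
  move=> /= -[[x [Kx _] <-] nU]; split; first by exists x.
  by rewrite /= fg ?inE//; apply: contrapT => nUx; apply: nU; exists x.
apply: measurableD; apply: borel_closed; apply: cim; first exact: closedT.
exact: open_closedC.
Qed.

End BorelMaps.

(** * Exchanging disjoint pieces *)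

Section ExchangePieces.
Context {R : realType} {T : ptopologicalType}.
Variables (mu : probability (borel T) R) (S : borel T -> borel T)
  (W : set (borel T)) (V : nat -> set (borel T)) (F G : nat -> borel T -> borel T).
Hypotheses (mS : measurable_fun setT S) (mW : measurable W)
  (mV : forall k, measurable (V k)) (tV : trivIset setT V)
  (SW : forall x, W x -> W (S x)) (SV : forall k x, V k (S x) <-> V k x)
  (FV : forall k x, V 0%N x -> V k (F k x))
  (GV : forall k x, V k x -> V 0%N (G k x))
  (FK : forall k x, V 0%N x -> G k (F k x) = x)
  (GK : forall k x, V k x -> F k (G k x) = x)
  (mF : forall k, measurable_fun (V 0%N) (F k))
  (mG : forall k, measurable_fun (V k) (G k))
  (FW : forall k x, V 0%N x -> W (F k x) <-> W x)
  (FS : forall k x, V 0%N x -> F k (S x) = S (F k x))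
  (muW : mu W = 1%E)
  (S_inv : forall B, measurable B -> mu (S @^-1` B) = mu B).

Lemma GS k x : V k x -> G k (S x) = S (G k x).
Proof.
move=> kx; have gx := GV kx; have sgx : V 0%N (S (G k x)) by exact/SV.
by rewrite -(FK k sgx) FS// GK.
Qed.

Lemma GW k x : V k x -> W (G k x) <-> W x.
Proof. by move=> kx; rewrite -(FW k (GV kx)) GK. Qed.

Lemma piece_disjoint j k x : V j x -> V k x -> j = k.
Proof. by move=> jx kx; apply: (tV (i := j) (j := k)) => //; exists x. Qed.

Lemma mu_setIW B : measurable B -> mu (W `&` B) = mu B.
Proof.
move=> mB; apply/eqP; rewrite eq_le; apply/andP; split.
  by apply: le_measure; rewrite ?inE//; exact: measurableI.
have W0 : mu (~` W) = 0%E by rewrite probability_setC// muW subee.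
rewrite -[leRHS]adde0 -W0.
apply: (@le_trans _ _ (mu ((W `&` B) `|` ~` W))).
  apply: le_measure; rewrite ?inE//.
    by apply: measurableU; [exact: measurableI|exact: measurableC].
  by move=> x Bx; have [?|?] := pselect (W x); [left|right].
by apply: measureU2; [exact: measurableI|exact: measurableC].
Qed.

(** Passing through the model piece [V 0] makes the two branches mutually inverse, so that they form
    a single Borel involution. *)
Definition exchange (a b : nat) (x : borel T) : borel T :=
  if x \in V a then F b (G a x) else if x \in V b then F a (G b x) else x.

Section Exchange.
Variables a b : nat.
Hypothesis ab : a <> b.

Lemma exchange_l x : V a x -> exchange a b x = F b (G a x).
Proof. by move=> ax; rewrite /exchange mem_set. Qed.

Lemma exchange_r x : V b x -> exchange a b x = F a (G b x).
Proof.
move=> bx; rewrite /exchange (mem_set bx) ifN//.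
by apply/negP; rewrite inE => /piece_disjoint /(_ bx).
Qed.

Lemma exchange_out x : ~ V a x -> ~ V b x -> exchange a b x = x.
Proof. by move=> nax nbx; rewrite /exchange !ifN//; apply/negP; rewrite inE. Qed.

Lemma exchangeP x (P : borel T -> Prop) :
  (V a x -> V b (F b (G a x)) -> P (F b (G a x))) ->
  (V b x -> V a (F a (G b x)) -> P (F a (G b x))) ->
  (~ V a x -> ~ V b x -> P x) -> P (exchange a b x).
Proof.
move=> Pl Pr Po; have [ax|nax] := pselect (V a x).
  by rewrite exchange_l//; apply: Pl => //; exact/FV/GV.
have [bx|nbx] := pselect (V b x); last by rewrite exchange_out//; exact: Po.
by rewrite exchange_r//; apply: Pr => //; exact/FV/GV.
Qed.

Lemma exchangeK : involutive (exchange a b).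
Proof.
move=> x; apply: (@exchangeP x (fun y => exchange a b y = x)) => [ax by_|bx ay|].
- by rewrite exchange_r// FK ?GK//; exact: GV.
- by rewrite exchange_l// FK ?GK//; exact: GV.
- exact: exchange_out.
Qed.

Lemma exchangeW x : W (exchange a b x) <-> W x.
Proof.
apply: (@exchangeP x (fun y => W y <-> W x)) => [ax _|bx _|//].
  by rewrite FW ?GW//; exact: GV.
by rewrite FW ?GW//; exact: GV.
Qed.

Lemma exchangeS x : exchange a b (S x) = S (exchange a b x).
Proof.
have [ax|nax] := pselect (V a x).
  have sx : V a (S x) by exact/SV.
  by rewrite !exchange_l// GS// FS//; exact: GV.
have [bx|nbx] := pselect (V b x).
  have sx : V b (S x) by exact/SV.
  by rewrite !exchange_r// GS// FS//; exact: GV.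
by rewrite !exchange_out// => /SV.
Qed.

Lemma exchange_Vr x : V b (exchange a b x) <-> V a x.
Proof.
apply: (@exchangeP x (fun y => V b y <-> V a x)) => //.
by move=> bx ay; split=> [/(piece_disjoint ay)//|/piece_disjoint /(_ bx)].
Qed.

Lemma exchange_V c x : c <> a -> c <> b -> V c (exchange a b x) <-> V c x.
Proof.
move=> ca cb; apply: (@exchangeP x (fun y => V c y <-> V c x)) => //.
  by move=> ax yb; split=> [/piece_disjoint/(_ yb)//|/piece_disjoint/(_ ax)].
by move=> bx ya; split=> [/piece_disjoint/(_ ya)//|/piece_disjoint/(_ bx)].
Qed.

Lemma measurable_exchange : measurable_fun setT (exchange a b).
Proof.
have mFG j k : measurable_fun (V j) (F k \o G j).
  have GV0 : G j @` V j `<=` V 0%N by move=> _ [x jx <-]; exact: GV.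
  exact: (measurable_comp (mV 0%N) GV0 (@mF k) (@mG j)).
move=> _ B mB; rewrite setTI.
have -> : exchange a b @^-1` B = (V a `&` (F b \o G a) @^-1` B) `|`
    ((V b `&` (F a \o G b) @^-1` B) `|` (~` (V a `|` V b) `&` B)).
  apply/seteqP; split=> x; rewrite /preimage /=.
    apply: (@exchangeP x (fun y => B y -> _)) => [ax _|bx _|nax nbx] Bx.
    - by left.
    - by right; left.
    - by right; right; split => // -[].
  case=> [[ax]|[[bx]|[/not_orP[nax nbx]]]].
  - by rewrite exchange_l.
  - by rewrite exchange_r.
  - by rewrite exchange_out.
apply: measurableU; first exact: mFG.
apply: measurableU; first exact: mFG.
by apply: measurableI => //; apply: measurableC; exact: measurableU.
Qed.

(** The exchange is a Borel involution that commutes with [S] and preserves [W]. The image measure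
    is therefore invariant, and the exchange serves as the isomorphism in both directions. *)
Lemma exchange_isomorphic : exists nu : probability (borel T) R,
  [/\ forall B, nu B = mu (exchange a b @^-1` B),
      invariant_measure S W nu & meas_isomorphic S W nu mu].
Proof.
have [nu nuE] := probability_image mu measurable_exchange.
have preW : exchange a b @^-1` W = W by apply/funext => x; exact/propext/exchangeW.
have nuW : nu W = 1%E by rewrite nuE preW.
have mex B : measurable B -> measurable (exchange a b @^-1` B).
  by move=> mB; rewrite -[X in measurable X]setTI; exact: measurable_exchange.
exists nu; split=> //.
  split=> // B mB; rewrite !nuE.
  have -> : exchange a b @^-1` (W `&` S @^-1` B) =
      W `&` S @^-1` (exchange a b @^-1` B).
    rewrite preimage_setI preW; congr (_ `&` _).
    by apply/funext => x; rewrite /preimage /= exchangeS.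
  rewrite mu_setIW; last by rewrite -[X in measurable X]setTI; exact: mS (mex _ mB).
  by rewrite S_inv//; exact: mex.
have WW : set_fun W W (exchange a b) by move=> x /exchangeW.
have mexW : measurable_fun W (exchange a b).
  by apply: measurable_funS measurable_exchange => //.
exists W, W, (exchange a b), (exchange a b).
split; [by split|by split| |by []|].
  by split => // x _; exact: exchangeK.
split=> [B mB|x _]; last exact: exchangeS.
rewrite nuE preimage_setI preW -comp_preimage.
have -> : exchange a b \o exchange a b = id.
  by apply/funext => x /=; exact: exchangeK.
exact: mu_setIW.
Qed.

End Exchange.

Lemma infinite_isomorphic_measures a : (0 < mu (V a))%E ->
  infinite_set (isomorphic_measures S W mu).
Proof.
move=> a0; have [N NP] := probability_trivIset_cvg0 mu mV tV a0.
(* These indices exceed [a], and their pieces have mass below that of [V a]. Exchanging [a] with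
   [t n] gives [V (t n)] the mass of [V a], while the exchange with any other [t m] leaves it its
   smaller mass; so the measures are distinct. *)
pose t n := (maxn N a.+1 + n)%N.
have Nt n : (N <= t n)%N by apply: leq_trans (leq_maxl _ _) (leq_addr _ _).
have at_ n : a <> t n.
  move=> at_; have := leq_trans (leq_maxr N a.+1) (leq_addr n _).
  by rewrite -/(t n) -at_ ltnn.
have [nu nuP] := choice (fun n => exchange_isomorphic (at_ n)).
apply: (@infinite_range_inj _ _ (fun n => borel_values (nu n))); last first.
  by move=> _ [n _ <-]; have [_ ? ?] := nuP n; exists (nu n).
move=> m n /(congr1 (fun v => v (V (t n)))).
rewrite /borel_values asboolT//; have [-> _ _] := nuP m; have [-> _ _] := nuP n.
have -> : exchange a (t n) @^-1` V (t n) = V a.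
  by apply/funext => x; exact/propext/exchange_Vr.
have [mn|mn] := eqVneq (t m) (t n); first by move=> _; move/addnI : mn.
have -> : exchange a (t m) @^-1` V (t n) = V (t n).
  apply/funext => x; apply/propext/exchange_V => //; first exact/nesym.
  by apply/eqP; rewrite eq_sym.
by move=> mu_tn; have := NP _ (Nt n); rewrite mu_tn ltxx.
Qed.

End ExchangePieces.

(** * The pieces of the product *)

(** For fixed [x] the codings for [beta k] converge coordinatewise to the Sturmian one: a point
    below [alpha] is eventually below [beta k], and a point at or above [alpha] is never below
    it. *)
Lemma coding_shift_sub_union {R : realType} (alpha : R) (beta : nat -> R) :
  (forall i, beta i < alpha) -> beta @ \oo --> alpha ->
  coding_shift alpha alpha `<=` coding_union alpha beta.
Proof.
move=> beta_lt beta_lim z zX; apply/closure_configP => m.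
have /closure_configP/(_ m)[_ [x /= x01 <-] xz] := zX.
rewrite in_itv /= in x01.
have [K _ KP] : \forall k \near \oo, forall j : 'I_(m + m).+1,
    coding alpha (beta k) x (j%:Z - m%:Z) = coding alpha alpha x (j%:Z - m%:Z).
  apply: filter_forall => j; rewrite codingE//.
  set u := mod1 _; have [ua|au] := ltP u alpha.
    have : 0 < alpha - u by rewrite subr_gt0.
    move/cvgrPdist_lt : beta_lim => /[apply]; apply: filterS => k.
    rewrite codingE// -/u gtr0_norm ?subr_gt0// => uk.
    by congr (~~ _); apply/idP; lra.
  apply: nearW => k; rewrite codingE// -/u; congr (~~ _); apply/negbTE.
  by rewrite -leNgt (le_trans (ltW (beta_lt k))).
exists (coding alpha (beta K) x).
  by exists K => //; apply: subset_closure; exists x.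
move=> j jm; rewrite -xz//.
have jlt : (absz (j + m%:Z)%R < (m + m).+1)%N by lia.
have jE : (absz (j + m%:Z)%R)%:Z - m%:Z = j by lia.
by have := KP K (leqnn K) (Ordinal jlt); rewrite /= jE.
Qed.

Lemma coding_union_translate {R : realType} (alpha : R) (beta : nat -> R)
    (t : int) z :
  coding_union alpha beta z -> coding_union alpha beta (fun j => z (j + t)).
Proof.
move=> /(local_map_closure (@translate_local _ t)).
apply: closure_subset => _ [y [k _ yk] <-].
by exists k => //; exact: (coding_shift_translate (t := t) yk).
Qed.

Lemma iter_left_shift {A : Type} n (w : config A) (j : int) :
  iter n left_shift w j = w (j + n%:Z).
Proof.
elim: n j => [|n IH] j; first by rewrite addr0.
by rewrite iterS {1}/left_shift IH; congr w; lia.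
Qed.

Lemma left_shift_translate {A : finType} (X : set (config A)) :
  subshift X -> forall w, X w -> X (left_shift w) /\ X (fun j => w (j - 1)).
Proof.
case=> _ _ SX w Xw; split; first by rewrite -SX; exists w.
move: (Xw); rewrite -{1}SX => -[y Xy yw]; suff -> : (fun j => w (j - 1)) = y by [].
by apply/funext => j; rewrite -yw /left_shift subrK.
Qed.

Definition map_snd {A : Type} (f : config bool -> config bool)
    (w : config (A * bool)) : config (A * bool) :=
  fun j => ((w j).1, f (snd \o w) j).

Lemma map_snd_local {A : Type} f : local_map f -> local_map (@map_snd A f).
Proof.
move=> lf m; have [n fn] := lf m; exists (maxn m n) => z y yz j jm.
rewrite /map_snd (yz j) ?(leq_trans jm (leq_maxl _ _))//; congr (_, _).
by apply: fn jm => i ijn /=; rewrite yz// (leq_trans ijn (leq_maxr _ _)).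
Qed.

Lemma closed_pointwise {A B : choiceType} (f : A -> B) (K : set (config B)) :
  closed K -> closed [set w : config A | K (f \o w)].
Proof.
apply: (@closed_comp (config A) (config B) (fun w => f \o w)) => w _.
exact/local_map_continuous/local_map_pointwise.
Qed.

Lemma lt_increasing_limit {R : realType} (u : nat -> R) (l : R) :
  {homo u : m n / (m < n)%N >-> m < n} -> u @ \oo --> l -> forall n, u n < l.
Proof.
move=> u_incr u_lim n; apply: lt_le_trans (u_incr _ _ (ltnSn n)) _.
rewrite -(cvg_lim (@Rhausdorff R) u_lim); apply: nondecreasing_cvgn_le.
  by move=> i j; rewrite leq_eqVlt => /predU1P[->//|/u_incr/ltW].
by apply/cvg_ex; exists l.
Qed.

Section Product.
Context {R : realType} {alpha : R} {beta : nat -> R} {X : set (config bool)}.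
Hypotheses (alpha01 : 0 < alpha < 1) (alpha_irr : irrational alpha)
  (beta_incr : {homo beta : m n / (m < n)%N >-> m < n})
  (beta_orbit : forall m, exists2 n, (1 <= n)%N & beta m = mod1 (n%:R * alpha))
  (beta_lim : beta @ \oo --> alpha) (X_subshift : subshift X).

Let T := config (bool * bool * bool).
Let Z := coding_union alpha beta.
Let W : set (borel T) := prod_shift (prod_shift X setT) Z.

Let beta_lt : forall i, beta i < alpha := lt_increasing_limit beta_incr beta_lim.

Lemma prod_shift_closed : closed (W : set T).
Proof.
have XC : closed X by case: X_subshift.
have -> : (W : set T) =
    [set w | X ((fun p => p.1.1) \o w)] `&` [set w | Z (snd \o w)].
  by apply/seteqP; split => w [] // [].
by apply: closedI; apply: closed_pointwise => //; exact: closed_closure.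
Qed.

Lemma prod_shift_translate w : W w ->
  W (left_shift w) /\ W (fun j => w (j - 1)).
Proof.
move=> [[Xw _] wZ]; have [Xl Xr] := left_shift_translate X_subshift Xw.
split; split; [by split|exact: (coding_union_translate (t := 1) wZ)|by split|].
exact: (coding_union_translate (t := -1) wZ).
Qed.

Lemma far_from_codings_borel m :
  measurable ([set w | far_from_codings alpha m (snd \o w)] : set (borel T)).
Proof.
apply: (@borel_closed T); rewrite -openC; apply/open_configP => w /existsNP[x].
move=> /not_implyP[x01 /contrapT xw]; exists m => v vw /(_ x x01); apply.
by move=> j jm; rewrite xw// /= vw.
Qed.

Section Pieces.
Variable slope : nat -> nat.
Hypotheses (slope_gt0 : forall m, (0 < slope m)%N)
  (slopeE : forall m, beta m = mod1 ((slope m)%:R * alpha)).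

(** Piece 0 is the Sturmian shift itself, as [1 * alpha] is [alpha]; piece [m.+1] belongs to
    [beta m]. *)
Let N (k : nat) := if k is m.+1 then slope m else 1%N.
Let V (k : nat) : set (borel T) :=
  [set w | coding_shift alpha (mod1 ((N k)%:R * alpha)) (snd \o w)].
Let F (k : nat) : borel T -> borel T := map_snd (arc_code alpha (N k)).
(** The inverse of [F k] on [V k], by choice of a preimage; a point without a preimage in [V 0] gets
    the default value [w]. *)
Let G (k : nat) (w : borel T) : borel T :=
  xget w [set y | V 0%N y /\ F k y = w].

Let N_gt0 k : (0 < N k)%N. Proof. by case: k. Qed.

Let V0E w : V 0%N w = coding_shift alpha alpha (snd \o w).
Proof. by rewrite /V /= mul1r alpha_mod1. Qed.

Let VSE k w : V k.+1 w = coding_shift alpha (beta k) (snd \o w).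
Proof. by rewrite /V /= -slopeE. Qed.

Let V_closed k : closed (V k : set T).
Proof.
apply: closed_pointwise; exact: closed_closure.
Qed.

(** A common point forces equal slopes, whereas the [beta m] increase strictly and stay below
    [alpha]. *)
Let V_trivIset : trivIset setT V.
Proof.
move=> j k _ _ [w [jw kw]]; have := coding_shift_slope alpha01 jw kw.
case: j k {jw kw} => [|j] [|k] //=; rewrite -?slopeE ?mul1r ?alpha_mod1//.
- by move=> ab; have := beta_lt k; rewrite -ab ltxx.
- by move=> ab; have := beta_lt j; rewrite ab ltxx.
- move=> bjk; have [jk|kj|->//] := ltngtP j k.
    by have := beta_incr jk; rewrite bjk ltxx.
  by have := beta_incr kj; rewrite bjk ltxx.
Qed.

Let V_shift k w : V k (left_shift w) <-> V k w.
Proof. exact: (left_shift_coding_shift _ (snd \o w)). Qed.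

Let V_sub k w : V k w -> Z (snd \o w).
Proof.
case: k => [|k]; first by rewrite V0E; exact: coding_shift_sub_union.
by rewrite VSE => kw; apply: subset_closure; exists k.
Qed.

Let FV k w : V 0%N w -> V k (F k w).
Proof.
by rewrite V0E /V /= -(arc_code_image alpha01) => w0; exists (snd \o w).
Qed.

Let F_inj k : {in V 0%N &, injective (F k)}.
Proof.
move=> v w /set_mem v0 /set_mem w0 Fvw; move: v0 w0; rewrite !V0E => v0 w0.
have e : snd \o v = snd \o w.
  apply: (arc_code_inj alpha01 alpha_irr (N_gt0 k) v0 w0).
  by apply/funext => j; exact: (congr1 (fun u : T => (u j).2) Fvw).
apply/funext => j; rewrite [v j]surjective_pairing [w j]surjective_pairing.
congr (_, _); first exact: (congr1 (fun u : T => (u j).1) Fvw).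
exact: (congr1 (fun u : config bool => u j) e).
Qed.

Let F_surj k w : V k w -> exists v, V 0%N v /\ F k v = w.
Proof.
rewrite /V /= -(arc_code_image alpha01) => -[z z0 zw].
exists (fun j => ((w j).1, z j)); split; first by rewrite mul1r alpha_mod1.
apply/funext => j; rewrite /F /map_snd /= [RHS]surjective_pairing.
by congr (_, _); rewrite -[(w j).2]/((snd \o w) j) -zw.
Qed.

Let GP k w : V k w -> V 0%N (G k w) /\ F k (G k w) = w.
Proof.
move=> /F_surj[v vP].
by apply: (xgetPex w (P := [set y | V 0%N y /\ F k y = w])); exists v.
Qed.

Let FK k w : V 0%N w -> G k (F k w) = w.
Proof.
move=> w0; have [g0 gE] := GP (FV (k := k) w0).
by apply: (F_inj (k := k)); rewrite ?inE.
Qed.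

Let F_continuous k : continuous (F k : T -> T).
Proof. exact/local_map_continuous/map_snd_local/arc_code_local. Qed.

Let F_borel k : measurable_fun (V 0%N) (F k).
Proof.
have mF : measurable_fun setT (F k) by exact: (@continuous_borel T).
exact: measurable_funS mF.
Qed.

Let G_borel k : measurable_fun (V k) (G k).
Proof.
have -> : V k = F k @` V 0%N.
  apply/seteqP; split=> [w /F_surj[v [v0 <-]]|_ [w w0 <-]]; first by exists v.
  exact: FV.
apply: (@compact_inverse_borel T) => //.
- exact: config_hausdorff.
- apply: (subclosed_compact (@V_closed 0%N) (@config_compact _)) => //.
- by move=> w /set_mem; exact: FK.
Qed.

(** Both pieces lie above [Z], and [F k] leaves the first two factors untouched. *)
Let FW k w : V 0%N w -> W (F k w) <-> W w.
Proof.
move=> w0; have wZ := V_sub w0; have FwZ := V_sub (FV (k := k) w0).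
by split=> -[[Xw _] _]; (do 2?split).
Qed.

Let FS k w : V 0%N w -> F k (left_shift w) = left_shift (F k w).
Proof.
move=> _; apply/funext => j; rewrite /F /map_snd {2}/left_shift; congr (_, _).
have := arc_code_shift alpha (N k) (snd \o w).
exact: (congr1 (fun z : config bool => z j)).
Qed.

Variable mu : probability (borel T) R.
Hypotheses (muW : mu W = 1%E)
  (mu_inv : forall B : set (borel T), measurable B ->
    mu (left_shift @^-1` B) = mu B).

Let shift_borel : measurable_fun setT (left_shift : borel T -> borel T).
Proof.
apply: (@continuous_borel T); exact/local_map_continuous/left_shift_local.
Qed.

Let V_borel k : measurable (V k).
Proof. exact: (@borel_closed T). Qed.

Let W_borel : measurable W.
Proof. apply: (@borel_closed T); exact: prod_shift_closed. Qed.

Let exists_charged : exists k, (0 < mu (V k))%E.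
Proof.
apply: contrapT => /forallNP V0.
have {}V0 k : mu (V k) = 0%E.
  by apply/eqP; rewrite -measure_le0 leNgt; apply/negP; exact: V0.
(* If all pieces were null, [W] would be covered by null sets: a point above no piece lies in some
   [E m], and by [far_from_codings_once] no point of [E m] is back in it after more than [2 * m]
   steps, so [E m] is null too. *)
pose E m : set (borel T) :=
  (W `&` ~` \bigcup_k V k) `&` [set w | far_from_codings alpha m (snd \o w)].
have mE m : measurable (E m).
  apply: measurableI; last exact: far_from_codings_borel.
  apply: measurableI => //; apply: measurableC; exact: bigcup_measurable.
have E0 m : mu (E m) = 0%E.
  apply: (wandering_null shift_borel mu_inv (p := (2 * m)%N) (mE m)).
  move=> n w mn [[[_ wZ] wV] wm] [_ wnm].
  have wn k : ~ coding_shift alpha (beta k) (snd \o w).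
    by move=> wk; apply: wV; exists k.+1 => //; rewrite VSE.
  apply: (far_from_codings_once alpha_irr beta_lt beta_lim wZ wn wm mn).
  have <- : snd \o iter n left_shift w = (fun j => (snd \o w) (j + n%:Z)) => //.
  by apply/funext => j /=; rewrite iter_left_shift.
have : mu.-negligible W.
  apply: (@negligibleS _ _ _ _ (\bigcup_k V k `|` \bigcup_m E m)).
    move=> w Ww; have [?|wV] := pselect ((\bigcup_k V k) w); first by left.
    have [|m wm] := @notin_coding_shift _ alpha (snd \o w); last by right; exists m.
    by rewrite -V0E => w0; apply: wV; exists 0%N.
  apply: negligibleU; apply: negligible_bigcup => k.
    exact: (negligibleP mu (V_borel k)).2 (V0 k).
  exact: (negligibleP mu (mE k)).2 (E0 k).
move=> /(negligibleP mu W_borel) muW0; have : (1 = 0 :> \bar R)%E by rewrite -muW.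
by move/eqP; rewrite onee_eq0.
Qed.

Lemma infinite_isomorphic_pieces :
  infinite_set (isomorphic_measures left_shift W mu).
Proof.
have [a a0] := exists_charged.
apply: (@infinite_isomorphic_measures _ _ _ left_shift _ V F G) a0 => //.
- by move=> w /prod_shift_translate[].
- by move=> k w /GP[].
- by move=> k w /GP[].
Qed.

End Pieces.

Lemma infinite_isomorphic_prod (mu : probability (borel T) R) :
  invariant_measure left_shift W mu ->
  infinite_set (isomorphic_measures left_shift W mu).
Proof.
move=> [muW mu_inv].
have /choice[slope slopeP] : forall m, exists n,
    (0 < n)%N /\ beta m = mod1 (n%:R * alpha).
  by move=> m; have [n n0 nE] := beta_orbit m; exists n.
apply: (@infinite_isomorphic_pieces slope) => // [m|m|B mB].
- exact: (slopeP m).1.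
- exact: (slopeP m).2.
(* Since [W] has full mass, intersecting the preimage with [W] does not change its measure. *)
- have mW : measurable W by apply: (@borel_closed T); exact: prod_shift_closed.
  have mS : measurable_fun setT (left_shift : borel T -> borel T).
    apply: (@continuous_borel T); exact/local_map_continuous/left_shift_local.
  have mSB : measurable (left_shift @^-1` B : set (borel T)).
    by rewrite -[X in measurable X]setTI; exact: mS.
  by rewrite -(mu_setIW mW muW mSB); exact: mu_inv.
Qed.

(** The shift is itself an automorphism of [W], with the backward translation as inverse. *)
Lemma characteristic_invariant (mu : probability (borel T) R) :
  characteristic left_shift W mu -> invariant_measure left_shift W mu.
Proof.
case=> muW mu_aut; split=> //; apply: mu_aut.
exists (fun w j => w (j - 1)); split.
- by split=> w /prod_shift_translate[].
- by split=> w _; apply/funext => j; rewrite /left_shift ?addrK ?subrK.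
- split; apply: continuous_subspaceT.
    exact/local_map_continuous/left_shift_local.
  exact/local_map_continuous/translate_local.
- by [].
Qed.

End Product.

Theorem lemma6p16 (R : realType) (alpha : R) (beta : nat -> R)
  (i_ j_ : nat -> nat) (X : set (config bool))
  (alpha01 : 0 < alpha < 1)
  (alpha_irr : irrational alpha)
  (beta_incr : {homo beta : m n / (m < n)%N >-> m < n})
  (beta_orbit : forall m, exists2 n, (1 <= n)%N & beta m = mod1 (n%:R * alpha))
  (beta_lim : beta @ \oo --> alpha)
  (Z_stable : language_stable R (coding_union alpha beta))
  (i_pos : forall n, (1 <= i_ n)%N)
  (i_incr : {homo i_ : m n / (m < n)%N})
  (j_incr : {homo j_ : m n / (m < n)%N})
  (Z_cover : forall n, SFT_cover (coding_union alpha beta) (i_ n) =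
                       SFT_cover (coding_union alpha beta) (i_ n + j_ n)%N)
  (X_stable : language_stable R X)
  (X_minimal : minimal_subshift X)
  (X_entropy : 0 < htop R X)
  (X_cover : infinite_set
    [set n | SFT_cover X (i_ n) = SFT_cover X (i_ n + j_ n)%N])
  (XZc_minimal : minimal_subshift (prod_shift X (coding_shift alpha alpha)))
  (XZj_minimal : forall j,
    minimal_subshift (prod_shift X (coding_shift alpha (beta j)))) :
  let Y : set (config bool) := setT in
  let Z := coding_union alpha beta in
  let W := prod_shift (prod_shift X Y) Z in
  (forall mu : probability (borel (config (bool * bool * bool))) R,
     characteristic left_shift W mu ->
     infinite_set (isomorphic_measures left_shift W mu)) /\
  ~ (exists mu : probability (borel (config (bool * bool * bool))) R,
       invariant_measure left_shift W mu /\
       finite_set (isomorphic_measures left_shift W mu)).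
Proof.
move=> Y Z W; have [X_subshift _] := X_minimal.
have infinite_iso := infinite_isomorphic_prod alpha01 alpha_irr beta_incr
  beta_orbit beta_lim X_subshift.
split=> [mu /(characteristic_invariant X_subshift)|[mu [mu_inv]]].
  exact: infinite_iso.
exact: infinite_iso.
Qed.
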